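(* The $\mathcal{P}$-positions of $\mathcal{F}_{\mathcal{R}}$-Wythoff are identical to those of $\mathcal{F}$-Wythoff, and the $\mathcal{P}$-positions of $\mathcal{F}_{\mathcal{E}}$-Wythoff are identical to those of $\mathcal{F}$-Wythoff.
   Context: $\lfloor\cdot\rfloor$ is the integer part. In all three games a position is an unordered pair $(a,b)$ of nonnegative integers (two piles of tokens), with $(a,b)$ identified with $(b,a)$; two players alternate moves and the player first unable to move loses. A $\mathcal{P}$-position is a position from which the player about to move has no winning strategy. $\mathcal{F}$-Wythoff has the following legal moves: (i) remove any positive number of tokens from one pile; (ii) remove the same positive number $k$ of tokens from both piles, provided the integer ratio of the two entries does not change, i.e. from $(a,b)$ with $1\le a\le b$ one may move to $(a-k,b-k)$ with $1\le k<a$ if $\lfloor (b-k)/(a-k)\rfloor=\lfloor b/a\rfloor$. $\mathcal{F}_{\mathcal{R}}$-Wythoff is the restriction of $\mathcal{F}$-Wythoff in which, if the two piles have different sizes, a move of type (i) cannot be made on the smaller pile (all other moves of $\mathcal{F}$-Wythoff remain legal). $\mathcal{F}_{\mathcal{E}}$-Wythoff is the extension of $\mathcal{F}$-Wythoff obtained by adding the following moves: from $(a,b)$ with $a\le b$, one can remove $k$ tokens from the pile of size $a$ and $l\le k$ tokens from the pile of size $b$, provided the integer ratio of the two entries does not change, i.e. with $1\le k<a$, $0\le l\le k$ and $\lfloor (b-l)/(a-k)\rfloor=\lfloor b/a\rfloor$. *)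

(* Defs.v *)
From mathcomp Require Import all_boot.
Set Implicit Arguments.
Unset Strict Implicit.
Unset Printing Implicit Defensive.

(* An unordered pair is represented by its nondecreasing arrangement; [pos a b]
   is the unordered pair of a and b, for a and b in any order. *)
Definition position := {p : nat * nat | p.1 <= p.2}.

Fact pos_subproof (a b : nat) : (minn a b, maxn a b).1 <= (minn a b, maxn a b).2.
Proof. exact: leq_trans (geq_minl a b) (leq_maxl a b). Qed.

Definition pos (a b : nat) : position :=
  exist _ (minn a b, maxn a b) (pos_subproof a b).

Lemma pos_sym (a b : nat) : pos a b = pos b a.
Proof. by apply: val_inj; rewrite /= minnC maxnC. Qed.

Lemma pos_surj (x : position) : exists a b, a <= b /\ x = pos a b.
Proof.
case: x => [[a b] /= le_ab]; exists a, b; split=> //.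
by apply: val_inj; rewrite /= (minn_idPl le_ab) (maxn_idPr le_ab).
Qed.

Lemma pos_inj (a b c d : nat) :
  pos a b = pos c d -> (a = c /\ b = d) \/ (a = d /\ b = c).
Proof.
move=> /(congr1 val) /= [].
by case: (leqP a b) => _; case: (leqP c d) => _ -> ->; auto.
Qed.

(* A derivation of [wins move x] is a winning strategy for the player about to move
   at x: a legal move to some y, and a winning strategy for every possible reply
   of the opponent (there is none if the opponent cannot move, and thus loses). *)
Inductive wins (move : position -> position -> Prop) (x : position) : Prop :=
  Wins y of move x y & (forall z, move y z -> wins move z).

Definition P_position (move : position -> position -> Prop) (x : position) :
    Prop :=
  ~ wins move x.

(* By [pos_sym], either pile may play the role of the second argument b. *)
Inductive single_pile_move : position -> position -> Prop :=
  SinglePile a b k of 0 < k & k <= b :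
    single_pile_move (pos a b) (pos a (b - k)).

(* Because of a <= b, the pile b from which tokens are removed is never the
   smaller of two different piles. *)
Inductive restricted_single_pile_move : position -> position -> Prop :=
  RestrictedSinglePile a b k of a <= b & 0 < k & k <= b :
    restricted_single_pile_move (pos a b) (pos a (b - k)).

Inductive both_piles_move : position -> position -> Prop :=
  BothPiles a b k of 1 <= a & a <= b & 1 <= k & k < a
                   & (b - k) %/ (a - k) = b %/ a :
    both_piles_move (pos a b) (pos (a - k) (b - k)).

Inductive extension_move : position -> position -> Prop :=
  Extension a b k l of a <= b & 1 <= k & k < a & l <= k
                     & (b - l) %/ (a - k) = b %/ a :
    extension_move (pos a b) (pos (a - k) (b - l)).

Definition F_move (x y : position) : Prop :=
  single_pile_move x y \/ both_piles_move x y.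

Definition FR_move (x y : position) : Prop :=
  restricted_single_pile_move x y \/ both_piles_move x y.

Definition FE_move (x y : position) : Prop :=
  F_move x y \/ extension_move x y.

(* Main.v *)
Require Import Defs.
From mathcomp Require Import all_boot.
From mathcomp Require Import zify.

(** The three games share the P-positions (0, 0) and (A n, A n + n), n >= 0, where
    A n is the least positive integer outside {A m, A m + m | m < n} (Wythoff's
    pairs translated by (1, 1)). Along these pairs both the smaller entry and the
    difference increase strictly, whereas an extension move decreases the smaller
    entry without decreasing the difference: no move of FE joins two of the pairs.
    Conversely, as A n + n < 2 A n, the diagonal moves of Wythoff's usual strategy
    keep the ratio 1, and its single-pile moves never need the smaller pile, so
    every other position has a move of FR to one of the pairs. *)

(** A strategy that starts in [S] leaves [S], and the reply given by absorption returns to [S] with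
    a smaller strategy, so induction excludes it. Outside [S], moving into [S] wins by induction on
    [rank]. *)
Lemma kernel_P_position (move : position -> position -> Prop)
    (rank : position -> nat) (S : pred position) :
    (forall x y, move x y -> rank y < rank x) ->
    (forall x y, move x y -> S x -> ~~ S y) ->
    (forall x, ~~ S x -> exists2 y, move x y & S y) ->
  forall x, P_position move x <-> S x.
Proof.
move=> rank_lt S_indep S_abs.
have winsN x : wins move x -> ~~ S x.
  elim=> {}x y xy _ IH; apply/negP=> Sx.
  have [z yz Sz] := S_abs y (S_indep x y xy Sx).
  by have := IH z yz; rewrite Sz.
have winsS n : forall x, rank x < n -> ~~ S x -> wins move x.
  elim: n => // n IH x lt_xn NSx; have [y xy Sy] := S_abs x NSx.
  apply: (Wins xy) => z yz; apply: IH (S_indep y z yz Sy).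
  by have := rank_lt _ _ xy; have := rank_lt _ _ yz; lia.
move=> x; split=> [Px | Sx /winsN]; last by rewrite Sx.
by apply/negPn/negP=> /(winsS (rank x).+1 x (ltnSn _)).
Qed.

(** By pigeonhole, one of the [(size s).+1] candidates is missing from [s], so the search
    succeeds. *)
Definition mex (s : seq nat) : nat :=
  find [predC s] (iota 0 (size s).+1).

Lemma mex_notin (s : seq nat) : mex s \notin s.
Proof.
have hasN : has [predC s] (iota 0 (size s).+1).
  apply: contraT; rewrite has_predC negbK => /allP sub.
  by have := uniq_leq_size (iota_uniq 0 _) sub; rewrite size_iota ltnn.
have := nth_find 0 hasN; rewrite nth_iota ?add0n //.
by rewrite -[X in _ < X](size_iota 0) -has_find.
Qed.

Lemma lt_mex (s : seq nat) (x : nat) : x < mex s -> x \in s.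
Proof.
move=> lt_x; have := before_find 0 lt_x.
have := leq_trans lt_x (find_size _ _); rewrite size_iota => lt_xs.
by rewrite nth_iota // add0n => /negbFE.
Qed.

(** The initial 0 makes every [A n] positive, which produces the translation of Wythoff's pairs by
    (1, 1). *)
Fixpoint used (n : nat) : seq nat :=
  if n is n'.+1 then [:: mex (used n'), mex (used n') + n' & used n'] else [:: 0].

Definition A (n : nat) : nat := mex (used n).

Lemma usedP (n x : nat) :
  reflect (x = 0 \/ exists2 m, m < n & x = A m \/ x = A m + m) (x \in used n).
Proof.
apply: (iffP idP).
  elim: n => [|n IH]; first by rewrite inE => /eqP; left.
  rewrite /= !inE => /or3P[/eqP xn | /eqP xn | /IH[x0 | [m lt_mn xm]]].
  - by right; exists n => //; left.
  - by right; exists n => //; right.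
  - by left.
  - by right; exists m => //; apply: ltnW.
elim: n => [|n IH]; first by case=> [-> | [m]].
case=> [x0 | [m]]; first by rewrite /= !inE IH ?orbT //; left.
rewrite ltnS leq_eqVlt => /orP[/eqP-> | lt_mn] xm.
  by rewrite /= !inE -/(A n); case: xm => ->; rewrite eqxx ?orbT.
by rewrite /= !inE IH ?orbT //; right; exists m.
Qed.

(** Everything below [A n] is in [used n], and [A n] itself enters [used n.+1]. *)
Lemma A_ltS (n : nat) : A n < A n.+1.
Proof.
rewrite ltnNge; apply/negP=> le_A.
have := mex_notin (used n.+1); rewrite -/(A n.+1) /= !inE -/(A n).
move: le_A; rewrite leq_eqVlt => /orP[-> // | /lt_mex ->].
by rewrite !orbT.
Qed.

Lemma A_lt : {mono A : m n / m < n}.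
Proof. exact/leqW_mono/leq_mono/(homo_ltn ltn_trans)/A_ltS. Qed.

Lemma A_le : {mono A : m n / m <= n}.
Proof. by move=> m n; rewrite leqNgt A_lt -leqNgt. Qed.

Lemma ltn_A (n : nat) : n < A n.
Proof.
elim: n => [|n IH]; last exact: leq_ltn_trans IH (A_ltS n).
have := mex_notin (used 0); rewrite -/(A 0) inE; lia.
Qed.

Lemma A_cover (x : nat) : 0 < x -> exists n, x = A n \/ x = A n + n.
Proof.
move=> x0; have /lt_mex/usedP[x00 | [n _ xn]] := ltn_A x; first by lia.
by exists n.
Qed.

(** If [m < n], then [A m + m] is in [used n] and cannot be its mex. Hence [n <= m], so [A n <= A m]
    and [m = 0]. *)
Lemma A_eq_AD (m n : nat) : A n = A m + m -> n = 0 /\ m = 0.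
Proof.
move=> eqA; have le_nm : n <= m.
  rewrite leqNgt; apply/negP=> lt_mn; have /usedP := mex_notin (used n).
  by case; right; exists m => //; right.
by move: le_nm (le_nm); rewrite -{1}A_le; lia.
Qed.

(** The index of a pair is the difference of its entries. The pair (0, 0) is apart, since [A 0] is
    positive. *)
Definition kernel (x : position) : bool :=
  ((val x).2 == 0) || ((val x).1 == A ((val x).2 - (val x).1)).

Lemma kernel_le (a b : nat) :
  a <= b -> kernel (pos a b) = (b == 0) || (a == A (b - a)).
Proof. by move=> le_ab; rewrite /kernel /= (minn_idPl le_ab) (maxn_idPr le_ab). Qed.

Lemma kernel_A (n : nat) : kernel (pos (A n) (A n + n)).
Proof. by rewrite kernel_le ?leq_addr // addKn eqxx orbT. Qed.

Lemma kernelP (a b : nat) : kernel (pos a b) ->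
  [\/ a = 0 /\ b = 0, exists n, a = A n /\ b = A n + n
    | exists n, a = A n + n /\ b = A n].
Proof.
wlog le_ab : a b / a <= b => [hw | ].
  case: (leqP a b) => [|/ltnW] le; first exact: hw.
  rewrite pos_sym => /(hw _ _ le)[[-> ->] | [n [-> ->]] | [n [-> ->]]].
  - by constructor 1.
  - by constructor 3; exists n.
  - by constructor 2; exists n.
rewrite kernel_le // => /orP[/eqP b0 | /eqP a_eq]; first by constructor 1; lia.
by constructor 2; exists (b - a); split=> //; lia.
Qed.

Lemma A_inj : injective A.
Proof. exact: incn_inj A_le. Qed.

Lemma AD_inj (m n : nat) : A m + m = A n + n -> m = n.
Proof.
have [lt_mn | lt_nm | //] := ltngtP m n.
  by move: (lt_mn); rewrite -A_lt; lia.
by move: (lt_nm); rewrite -A_lt; lia.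
Qed.

(** This excludes single-pile moves inside the kernel, whichever pile is kept. *)
Lemma kernel_uniq (a b c : nat) :
  kernel (pos a b) -> kernel (pos a c) -> b = c.
Proof.
move=> /kernelP[[-> ->] | [m [-> ->]] | [m [-> ->]]]
       /kernelP[[a0 ->] | [n [eqA ->]] | [n [eqA ->]]] //;
  try by [have := ltn_A n; lia | have := ltn_A m; lia].
- by rewrite (A_inj _ _ eqA).
- by have [-> ->] := A_eq_AD _ _ eqA.
- by have [-> ->] := A_eq_AD _ _ (esym eqA).
- by rewrite (AD_inj _ _ eqA).
Qed.

Lemma FR_sub_F (x y : position) : FR_move x y -> F_move x y.
Proof. by case=> [[a b k _ k0 kb] | ]; [left; constructor | right]. Qed.

(** A move on both piles is the extension move with [l = k]. *)
Lemma FE_moveP (x y : position) : FE_move x y ->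
  single_pile_move x y \/ extension_move x y.
Proof.
by case=> [[|[a b k a0 ab k0 ka eq_q]]|]; [left | right; constructor | right].
Qed.

Lemma kernel_indep (x y : position) : FE_move x y -> kernel x -> ~~ kernel y.
Proof.
move=> /FE_moveP[[a b k k0 kb] Kx | [a b k l ab k0 ka lk _]].
  by apply/negP=> /(kernel_uniq _ _ _ Kx); lia.
have le' : a - k <= b - l by lia.
rewrite !kernel_le // => /orP[|/eqP a_eq]; first by lia.
apply/negP=> /orP[|/eqP ak_eq]; first by lia.
(* Since [l <= k], the difference does not drop, so by monotonicity of [A] the smaller entry could
   not drop either; yet it becomes [a - k < a]. *)
suff: A (b - a) <= A (b - l - (a - k)) by lia.
by rewrite A_le; lia.
Qed.

Lemma kernel_abs (x : position) : ~~ kernel x -> exists2 y, FR_move x y & kernel y.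
Proof.
have reduce a b c : a <= b -> c < b -> FR_move (pos a b) (pos a c).
  move=> ab cb; have -> : c = b - (b - c) by lia.
  by left; constructor=> //; lia.
have [a [b [ab ->]]] := pos_surj x; have [-> | a0] := posnP a.
  have [-> | b0 _] := posnP b; first by rewrite kernel_le.
  by exists (pos 0 0); [apply: reduce | rewrite kernel_le].
have [n [an | an]] := A_cover a a0; last first.
  rewrite an pos_sym => NKb.
  (* With [b >= A n + n], this gives [A n < b], so the larger pile can be cut down to [A n]. *)
  have ne_b : b != A n by apply: contraNneq NKb => ->; apply: kernel_A.
  exists (pos a (A n)); last by rewrite an pos_sym kernel_A.
  rewrite pos_sym -an; apply: reduce => //; lia.
rewrite an; have [lt_b | lt_b | ->] := ltngtP b (A n + n); last by rewrite kernel_A.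
  (* A diagonal move keeps the difference [d], so its target is the pair of index [d], reached by
     removing [A n - A d] from both piles. *)
  move=> _; pose d := b - a; have lt_dn : d < n by lia.
  have lt_Ad : A d < A n by rewrite A_lt.
  have := ltn_A n; have := ltn_A d => ltd ltn.
  exists (pos (A d) (A d + d)); last exact: kernel_A.
  have -> : A d = A n - (A n - A d) by lia.
  have -> : A n - (A n - A d) + d = b - (A n - A d) by lia.
  (* Both ratios are 1: [b < A n + n < 2 * A n] before the move and [A d + d < 2 * A d] after it. *)
  have ratio1 u v : u <= v -> v < u + u -> v %/ u = 1.
    by move=> le_uv lt_v; rewrite -(subnK le_uv) divnDr ?dvdnn // divnn divn_small; lia.
  by right; constructor; rewrite ?ratio1; lia.
by move=> _; exists (pos (A n) (A n + n)); [apply: reduce; lia | exact: kernel_A].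
Qed.

Lemma FE_move_lt (x y : position) : FE_move x y ->
  (val y).1 + (val y).2 < (val x).1 + (val x).2.
Proof.
by case/FE_moveP=> [[a b k k0 kb] | [a b k l ab k0 ka lk _]];
  rewrite /= !addn_min_max; lia.
Qed.

(** Absorption passes to games with more moves than FR, independence and termination to games with
    fewer moves than FE; so every game between the two has the same P-positions. *)
Lemma P_position_kernel (move : position -> position -> Prop) :
    (forall x y, FR_move x y -> move x y) ->
    (forall x y, move x y -> FE_move x y) ->
  forall x, P_position move x <-> kernel x.
Proof.
move=> FR_move_sub sub_FE.
apply: (kernel_P_position _ (fun x => (val x).1 + (val x).2)) => [x y xy | x y xy | x].
- exact/FE_move_lt/sub_FE.
- exact/kernel_indep/sub_FE.
- by case/kernel_abs=> y xy Ky; exists y => //; apply: FR_move_sub.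
Qed.

Theorem theorem21 :
  (forall x : position, P_position FR_move x <-> P_position F_move x) /\
  (forall x : position, P_position FE_move x <-> P_position F_move x).
Proof.
have F_sub_FE x y : F_move x y -> FE_move x y by left.
have PF := P_position_kernel F_move FR_sub_F F_sub_FE.
have PFR : forall x, P_position FR_move x <-> kernel x.
  by apply: P_position_kernel => // x y /FR_sub_F/F_sub_FE.
have PFE : forall x, P_position FE_move x <-> kernel x.
  by apply: P_position_kernel => // x y /FR_sub_F/F_sub_FE.
by split=> x; rewrite PF.
Qed.
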